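(* There is a generating vector operator $\hat G$ such that for every fixed $L_2$-orthogonal system $\{f_n(t)\}_{n=0}^\infty$, $t\in[a,a+2l]$, $a\in\mathbb{R}$, $l\in\mathbb{R}^+$, and for every fixed $k\in\mathbb{N}$, the operator $\hat G$ associates the following orthogonal systems (with $u_p$, $v_p^r$, $\tilde Z$ as defined in the context). (a) The first generation of new $L_2$-orthogonal systems $\{f_n^{p_1}(t)\}_{n=0}^\infty$, $t\in[a,a+2l]$, $p_1=1,\dots,k$, i.e. $\hat G[\{f_n\}]=(\{f_n^{1}\},\{f_n^{2}\},\dots,\{f_n^{k}\})$, where $$f_n^{p_1}(t)=f_n(u_{p_1}(t))\prod_{r=0}^{p_1-1}\left|\tilde Z(v_{p_1}^r(t))\right|,$$ and each of the functions $u_{p_1}(t)$ defines an automorphism on $[a,a+2l]$. (b) The second generation of $L_2$-orthogonal systems $\{f_n^{p_1,p_2}(t)\}_{n=0}^\infty$, $t\in[a,a+2l]$, $p_1,p_2=1,\dots,k$, i.e. $\hat G[\{f_n^{p_1}\}]=(\{f_n^{p_1,1}\},\{f_n^{p_1,2}\},\dots,\{f_n^{p_1,k}\})$, where $$f_n^{p_1,p_2}(t)=f_n(u_{p_1}(u_{p_2}(t)))\prod_{r=0}^{p_1-1}\left|\tilde Z(v_{p_1}^r(u_{p_2}(t)))\right|\prod_{r=0}^{p_2-1}\left|\tilde Z(v_{p_2}^r(t))\right|,$$ and each of the functions $u_{p_1}(u_{p_2}(t))$ defines an automorphism on $[a,a+2l]$. (c) And so on up to the $s$-th generation of $L_2$-orthogonal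 systems $\{f_n^{p_1,\dots,p_s}(t)\}_{n=0}^\infty$, $t\in[a,a+2l]$, $p_1,\dots,p_s=1,\dots,k$, i.e. $$\hat G[\{f_n^{p_1,\dots,p_{s-1}}\}]=(\{f_n^{p_1,\dots,p_{s-1},1}\},\{f_n^{p_1,\dots,p_{s-1},2}\},\dots,\{f_n^{p_1,\dots,p_{s-1},k}\}),$$ where $$f_n^{p_1,\dots,p_s}(t)=f_n\big((u_{p_1}\circ u_{p_2}\circ\cdots\circ u_{p_s})(t)\big)\prod_{i=1}^{s}\ \prod_{r=0}^{p_i-1}\left|\tilde Z\Big(v_{p_i}^r\big((u_{p_{i+1}}\circ u_{p_{i+2}}\circ\cdots\circ u_{p_s})(t)\big)\Big)\right|$$ (for $i=s$ the empty composition is the identity, so the last factor is $\prod_{r=0}^{p_s-1}|\tilde Z(v_{p_s}^r(t))|$), and each of the functions $u_{p_1}(u_{p_2}(\dots(u_{p_s}(t))\dots))$ defines an automorphism on $[a,a+2l]$. (d) For every fixed $k,s\in\mathbb{N}$, to the systems $\{f_n^{p_1,\dots,p_s}(t)\}_{n=0}^\infty$ of (c) there corresponds the $L_2$-orthonormal system $$\left(\prod_{i=0}^{s}\sqrt{\frac{2l}{(T+2l)^{[i]}-T^{[i]}}}\right)f_n^{p_1,\dots,p_s}(t),\quad t\in[a,a+2l],\ p_1,\dots,p_s=1,\dots,k.$$ (e) All these formulas are true for all sufficiently large $T>0$; that is, there is a continuum set of possibilities for constructing new classes of $L_2$-orthogonal systems $\{f_n^{p_1,\dots,p_s}(t)\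}_{n=0}^\infty$.
   Context: **Orthogonal systems.** An $L_2$-orthogonal system on $[a,a+2l]$ is a sequence of functions $f_n\in L_2([a,a+2l])$, $n=0,1,2,\dots$, with $\int_a^{a+2l}f_m(t)f_n(t)\,dt=0$ for all $m\ne n$; it is orthonormal if also $\int_a^{a+2l}f_n(t)^2\,dt=1$ for all $n$. An automorphism on $[a,a+2l]$ here means a continuous increasing one-to-one map of $[a,a+2l]$ onto itself. **Jacob's ladder.** Let $Z(t)=e^{i\vartheta(t)}\zeta\left(\tfrac12+it\right)$ with $\vartheta(t)=-\tfrac t2\ln\pi+\operatorname{Im}\ln\Gamma\left(\tfrac14+i\tfrac t2\right)$, where $\zeta$ is the Riemann zeta-function. Let $\mu\in C^\infty([y_0,+\infty))$ be any monotonically increasing function, unbounded from above, with $\mu(y)\ge 7y\ln y$. Let $\varphi(T)=\varphi(T;\mu)$ be a continuous solution $x(T)=\varphi(T)$ of the nonlinear integral equation $$\int_0^{\mu[x(T)]}Z^2(t)e^{-\frac{2}{x(T)}t}\,dt=\int_0^T Z^2(t)\,dt.$$ Then $\varphi_1(t)=\tfrac12\varphi(t)$ is called a Jacob's ladder; one such $\varphi_1$ is fixed. **Known properties of $\varphi_1$ (from earlier work).** For some $T_0>0$, $\varphi_1\in C^\infty([T_0,\infty))$ is strictly increasing, and $$\tilde Z^2(t)=\frac{d\varphi_1(t)}{dt}=\frac{1}{\omega(t)}\left|\zeta\left(\tfrac12+it\right)\right|^2,\qquad \omega(t)=\left\{1+O\left(\frac{\ln\ln t}{\ln t}\right)\right\}\ln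 t,\quad t\to\infty,$$ and $|\tilde Z(t)|=\sqrt{d\varphi_1(t)/dt}$. **Iterations.** Direct iterations: $\varphi_1^0(t)=t$, $\varphi_1^1(t)=\varphi_1(t)$, $\varphi_1^{r}(t)=\varphi_1(\varphi_1^{r-1}(t))$. Reverse iterations: for large $X$ and a fixed integer $r\ge 0$, $X^{[r]}:=\varphi_1^{-r}(X)$ is the point with $\varphi_1^r(X^{[r]})=X$ (the $r$-fold iterate of the inverse function $\varphi_1^{-1}$ at $X$); so $X^{[0]}=X$. In particular $T^{[r]}$ and $(T+2l)^{[r]}$ are defined for all sufficiently large $T$. **The functions $u_p$, $v_p^r$.** For $p=1,\dots,k$, $r=0,1,\dots,p-1$ and $t\in[a,a+2l]$ put $$u_{p}(t)=\varphi_1^{p}\left(\frac{(T+2l)^{[p]}-T^{[p]}}{2l}(t-a)+T^{[p]}\right)-T+a,$$ $$v_{p}^r(t)=\varphi_1^{r}\left(\frac{(T+2l)^{[p]}-T^{[p]}}{2l}(t-a)+T^{[p]}\right).$$ These satisfy $u_p(t)\in[a,a+2l]$ and $v_p^r(t)\in\left[T^{[p-r]},(T+2l)^{[p-r]}\right]$. They depend on $T$, and so do the operator $\hat G$ and the systems $\{f_n^{p_1,\dots,p_s}\}$.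
   Formalization: In (d) the printed constant is false; it is replaced by the product over i=1..s of sqrt(((T+2l)^[p_i] - T^[p_i])/(2l)), i.e. the quotient is inverted and the index i becomes p_i, and {f_n} is assumed orthonormal there. *)

(* Defs.v *)
From HB Require Import structures.
From mathcomp Require Export all_boot all_order all_algebra.
From mathcomp Require Export all_classical all_reals all_analysis.
From mathcomp Require Export complex.
Export Order.TTheory GRing.Theory Num.Theory.
Export numFieldNormedType.Exports.

Set Implicit Arguments.
Unset Strict Implicit.
Unset Printing Implicit Defensive.

Local Open Scope classical_set_scope.
Local Open Scope ring_scope.
Local Open Scope complex_scope.

Section Zeta.
Variable R : realType.
Implicit Types (z s : R[i]) (t : R).

Definition cexp z : R[i] :=
  (expR (complex.Re z))%:C * (cos (complex.Im z) +i* sin (complex.Im z)).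

(* The principal logarithm, on the half-plane Re z > 0 only. *)
Definition cln z : R[i] :=
  ln (ComplexField.Normc.normc z) +i* atan (complex.Im z / complex.Re z).

(* zeta(s) = lim_N (\sum_(1 <= n <= N) n^(-s) - N^(1-s) / (1-s)), the analytic
   continuation of \sum_n n^(-s) to Re s > 0, s != 1. *)
Definition zeta s : R[i] :=
  lim ((fun N : nat =>
    \sum_(1 <= n < N.+1) cexp (- s * (ln n%:R)%:C)
    - cexp ((1 - s) * (ln N%:R)%:C) / (1 - s)) @ \oo : set_system R[i]^o).

(* The Euler-Gauss limit for the branch of ln Gamma on Re z > 0 that is real on
   the positive real axis. *)
Definition cln_Gamma z : R[i] :=
  lim ((fun N : nat =>
    z * (ln N%:R)%:C + (ln (N`!)%:R)%:C - \sum_(0 <= k < N.+1) cln (z + k%:R))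
    @ \oo : set_system R[i]^o).

Definition theta t : R :=
  - (t / 2) * ln pi + complex.Im (cln_Gamma ((1 / 4) +i* (t / 2))).

Definition zeta_half t : R[i] := zeta ((1 / 2) +i* t).

(* e^{i theta(t)} zeta(1/2 + i t) is a real number by the functional equation;
   taking the real part only changes its type. *)
Definition hardyZ t : R :=
  complex.Re (cexp (0 +i* theta t) * zeta_half t).

End Zeta.

Section Ladder.
Variable R : realType.
Implicit Types (g mu phi : R -> R) (c : R).

(* g is C^oo on [c, +oo[: d n is the n-th derivative of g, one-sided at c. *)
Definition smooth_ray c g : Prop :=
  exists d : nat -> R -> R,
    (forall x, c <= x -> d 0%N x = g x) /\
    (forall (n : nat) x, c <= x ->
      (fun y => (d n y - d n x) / (y - x))
        @ within [set y | c <= y] x^' --> d n.+1 x).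

Definition admissible_mu (y0 : R) mu : Prop :=
  [/\ 0 < y0,
      smooth_ray y0 mu,
      {in `[y0, +oo[ &, {homo mu : x y / x <= y}},
      (forall M, exists2 y, y0 <= y & M < mu y)
    & forall y, y0 <= y -> 7 * y * ln y <= mu y].

Definition continuous_solution (y0 : R) mu (Tstart : R) phi : Prop :=
  {within `[Tstart, +oo[, continuous phi} /\
  forall T, Tstart <= T ->
    y0 <= phi T /\
    \int[lebesgue_measure]_(t in `[0, mu (phi T)])
        (hardyZ t ^+ 2 * expR (- (2 / phi T) * t))
    = \int[lebesgue_measure]_(t in `[0, T]) (hardyZ t ^+ 2).

Definition ladder phi : R -> R := fun t => phi t / 2.

(* The facts on phi1 that are known from earlier work. The last one is what makes
   phi1 : [T0, +oo[ -> [phi1 T0, +oo[ onto, hence the reverse iterations defined. *)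
Definition ladder_properties (T0 : R) (phi1 : R -> R) : Prop :=
  [/\ 0 < T0,
      smooth_ray T0 phi1,
      {in `[T0, +oo[ &, {homo phi1 : x y / x < y}},
      (exists omega : R -> R,
        (forall t, T0 < t ->
          derive1 phi1 t =
            (omega t)^-1 * ComplexField.Normc.normc (zeta_half t) ^+ 2) /\
        (exists C : R, \forall t \near +oo,
          `|omega t / ln t - 1| <= C * (ln (ln t) / ln t)))
    & phi1 t @[t --> +oo] --> +oo].

(* Only the modulus of Ztilde, the square root of phi1', is ever used. *)
Definition absZtilde (phi1 : R -> R) (t : R) : R := Num.sqrt (derive1 phi1 t).

(* X^[r], the r-fold iterate at X of the inverse function of phi1 on [T0, +oo[. *)
Definition reverse_iter (T0 : R) (phi1 : R -> R) (r : nat) (X : R) : R :=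
  iter r (pinv `[T0, +oo[ phi1) X.

End Ladder.

Section Systems.
Variable R : realType.
Implicit Types (a b t : R) (f : nat -> R -> R) (u : R -> R).

Definition square_integrable a b (g : R -> R) : Prop :=
  measurable_fun `[a, b] g /\
  lebesgue_measure.-integrable `[a, b] (fun t => (g t ^+ 2)%:E).

Definition l2_orthogonal a b f : Prop :=
  (forall n, square_integrable a b (f n)) /\
  (forall m n : nat, m != n ->
    \int[lebesgue_measure]_(t in `[a, b]) (f m t * f n t) = 0).

Definition l2_orthonormal a b f : Prop :=
  l2_orthogonal a b f /\
  (forall n, \int[lebesgue_measure]_(t in `[a, b]) (f n t ^+ 2) = 1).

Definition automorphism a b u : Prop :=
  [/\ {within `[a, b], continuous u},
      {in `[a, b] &, {homo u : x y / x < y}}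
    & set_bij `[a, b] `[a, b] u].

End Systems.

Section Generations.
Variable R : realType.
Variables (T0 : R) (phi1 : R -> R) (a l T : R).

Definition rev_affine (p : nat) (t : R) : R :=
  (reverse_iter T0 phi1 p (T + 2 * l) - reverse_iter T0 phi1 p T) / (2 * l)
    * (t - a) + reverse_iter T0 phi1 p T.

Definition u_ (p : nat) (t : R) : R := iter p phi1 (rev_affine p t) - T + a.

Definition v_ (p r : nat) (t : R) : R := iter r phi1 (rev_affine p t).

(* u_{p_1} o ... o u_{p_s} for ps = [:: p_1; ...; p_s]. *)
Definition u_comp (ps : seq nat) (t : R) : R := foldr u_ t ps.

(* f_n^{p_1, ..., p_s}; the index i counts from 0, so that nth 0%N ps i is
   p_{i+1} and drop i.+1 ps is [:: p_{i+2}; ...; p_s]. *)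
Definition generation (f : nat -> R -> R) (ps : seq nat) (n : nat) (t : R) : R :=
  f n (u_comp ps t) *
  \prod_(i < size ps) \prod_(r < nth 0%N ps i)
    absZtilde phi1 (v_ (nth 0%N ps i) r (u_comp (drop i.+1 ps) t)).

(* The L2-norm of generation f ps n is that of f n times the product over i of
   sqrt (2l / ((T + 2l)^[p_i] - T^[p_i])), since the derivative of u_p is
   ((T + 2l)^[p] - T^[p]) / (2l) times the product of the Ztilde^2 (v_p^r). *)
Definition normalizer (ps : seq nat) : R :=
  \prod_(p <- ps)
    Num.sqrt ((reverse_iter T0 phi1 p (T + 2 * l) - reverse_iter T0 phi1 p T)
              / (2 * l)).

End Generations.

(* Main.v *)
(* The derivative of u_p is, by the chain rule, ((T + 2l)^[p] - T^[p]) / (2l) times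
   the product over r < p of phi1' (v_p^r) = Ztilde^2 (v_p^r). Hence the operator
   g |-> (g o u_p) * prod_r |Ztilde (v_p^r)| multiplies every L2 inner product on
   [a, a + 2l] by 2l / ((T + 2l)^[p] - T^[p]), and the s-th generation is obtained
   by applying s such operators in turn. "T large" is only needed for the points
   T^[r] and (T + 2l)^[r], r <= k, to exist and lie beyond T0. *)
From HB Require Import structures.
From mathcomp Require Import measurable_realfun ring lra.
Require Import Defs.
Set Implicit Arguments.
Unset Strict Implicit.
Unset Printing Implicit Defensive.
Local Open Scope classical_set_scope.
Local Open Scope ring_scope.

(** The [f_n] are merely square integrable, so the substitution x = u_p(t) is needed for measurable
    integrands, out of reach of a rule for continuous ones. It is therefore proved as an equality of
    measures and then applied to products of two L2 functions, which are integrable. Since [u_p]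
    fixes both ends of [a, a + 2l], the substitution leads back to the same interval and can be
    iterated. Every point fed to [phi1] must lie strictly beyond [T0], because at [T0] itself
    smoothness on the ray only gives a one-sided derivative. *)

(** * Measures given by a density *)

Section Density.
Local Open Scope ereal_scope.
Context d (X : measurableType d) (R : realType).
Variables (mu : {measure set X -> \bar R}) (w : X -> R).
Hypotheses (mw : measurable_fun setT w) (w0 : forall x, (0 <= w x)%R).

Import HBNNSimple.

(** The hypothesis is the case of indicators; linearity gives simple functions and monotone
    convergence the rest. *)
Lemma ge0_integral_density (nu : {measure set X -> \bar R}) (f : X -> \bar R) :
  (forall A, measurable A -> nu A = \int[mu]_(x in A) (w x)%:E) ->
  measurable_fun setT f -> (forall x, 0 <= f x) ->
  \int[nu]_x f x = \int[mu]_x (f x * (w x)%:E).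
Proof.
move=> nuE mf f0.
have mEw : measurable_fun setT (EFin \o w) by exact/measurable_EFinP.
have nnsfunE (g : {nnsfun X >-> R}) :
    \int[nu]_x (g x)%:E = \int[mu]_x ((g x)%:E * (w x)%:E).
  under [LHS]eq_integral do rewrite fimfunE -fsumEFin//.
  rewrite [LHS]ge0_integral_fsum//; last 2 first.
    - by move=> r; exact/measurable_EFinP/measurableT_comp.
    - by move=> n x _; rewrite EFinM nnfun_muleindic_ge0.
  under [RHS]eq_integral.
    move=> x _; rewrite fimfunE -fsumEFin// ge0_mule_fsuml; last first.
      by move=> r; rewrite EFinM nnfun_muleindic_ge0.
    over.
  rewrite [RHS]ge0_integral_fsum//; last 2 first.
    - move=> r; apply: emeasurable_funM => //; apply/measurable_EFinP.
      exact: measurableT_comp.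
    - move=> r x _; rewrite mule_ge0//; last by rewrite lee_fin.
      by rewrite EFinM nnfun_muleindic_ge0.
  (* [r] is a value of [g], hence nonnegative, so it may be taken out of the integral. *)
  apply: eq_fsbigr => r; rewrite inE => -[y _ gy].
  have mgr : measurable (g @^-1` [set r]) by exact: measurable_sfunP.
  rewrite integralZl_indic_nnsfun// integral_indic// setIT nuE//.
  under [RHS]eq_integral do rewrite EFinM -muleA.
  rewrite ge0_integralZl//; last 3 first.
    - by apply: emeasurable_funM => //; exact/measurable_EFinP.
    - by move=> x _; rewrite mule_ge0// lee_fin.
    - by rewrite lee_fin -gy.
  congr (_ * _); rewrite integral_mkcond; apply: eq_integral => x _.
  by rewrite epatch_indic muleC.
pose f_ := nnsfun_approx measurableT mf.
have f_cvg x : (f_ n x)%:E @[n --> \oo] --> f x.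
  by apply: cvg_nnsfun_approx.
transitivity (lim (\int[nu]_x (f_ n x)%:E @[n --> \oo])).
  rewrite -monotone_convergence//=.
  - by apply: eq_integral => ? _; apply/esym/cvg_lim.
  - by move=> n; exact/measurable_EFinP.
  - by move=> n ? _; rewrite lee_fin.
  - by move=> ? _ ? ? mn; rewrite lee_fin; exact/lefP/nd_nnsfun_approx.
under eq_fun do rewrite nnsfunE.
rewrite -monotone_convergence//=.
- by apply: eq_integral => x _; apply/cvg_lim => //; exact: cvgeZr.
- by move=> n; apply: emeasurable_funM => //; exact/measurable_EFinP.
- by move=> n ? _; rewrite mule_ge0// lee_fin.
- move=> ? _ ? ? mn; rewrite lee_wpmul2r ?lee_fin//.
  exact/lefP/nd_nnsfun_approx.
Qed.

Lemma density_measure : exists nu : {measure set X -> \bar R},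
  forall A, measurable A -> nu A = \int[mu]_(x in A) (w x)%:E.
Proof.
pose m A := \int[mu]_(x in A) (w x)%:E.
have m0 : m set0 = 0 by rewrite /m integral_set0.
have m_ge0 A : 0 <= m A by apply: integral_ge0 => x _; rewrite lee_fin.
have madd : semi_sigma_additive m.
  move=> /= F mF tF mUF; apply: cvg_toP.
    apply: ereal_nondecreasing_is_cvgn => i j ij.
    by apply: lee_sum_nneg_natr.
  rewrite /m ge0_integral_bigcup//; first exact/measurable_funTS/measurable_EFinP.
  by move=> x _; rewrite lee_fin.
pose mix := isMeasure.Build _ _ _ m m0 m_ge0 madd.
pose nu : {measure set X -> \bar R} := HB.pack m mix.
by exists nu.
Qed.

End Density.

(* u' may vanish (in the application, at the zeros of zeta on the critical line),
   so the inverse of u need not be differentiable: the change of variables is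
   obtained by showing that the image under u of the measure u'(t) dt is Lebesgue
   measure, which by uniqueness of measures need only be checked on rays. *)
Section ChangeOfVariables.
Context (R : realType) (a b : R) (u w : R -> R).
Hypotheses (ab : a < b) (cw : {within `[a, b], continuous w})
  (du : {in `[a, b], forall x : R, is_derive x 1 u (w x)})
  (incu : {in `[a, b] &, {homo u : x y / x < y}})
  (w0 : {in `[a, b], forall x, 0 <= w x}).
Local Notation mu := (@lebesgue_measure R).

Let cu : {within `[a, b], continuous u}.
Proof. by apply: derivable_within_continuous => x /du[]. Qed.

Let mono_u : {in `[a, b] &, {mono u : x y / x <= y}}.
Proof. exact: le_mono_in. Qed.

Let aab : a \in `[a, b]. Proof. by rewrite in_itv/= lexx ltW. Qed.
Let bab : b \in `[a, b]. Proof. by rewrite in_itv/= lexx ltW. Qed.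

(** The right end stays at [b] because, [u] being increasing, the preimage in [a, b] of a right ray
    that starts in [u a, u b] is an interval ending at [b]. *)
Let FTC c : c \in `[a, b] ->
  (\int[mu]_(t in `[c, b]) (w t)%:E = (u b - u c)%:E)%E.
Proof.
rewrite in_itv/= => /andP[ac]; rewrite le_eqVlt => /predU1P[->|cb].
  by rewrite subrr set_itv1 integral_set1.
have cbab x : x \in `[c, b] -> x \in `[a, b].
  by rewrite !in_itv/= => /andP[cx ->]; rewrite (le_trans ac).
have u_cont x : x \in `[c, b] -> u @ x --> u x.
  move=> /cbab/du[dux _]; exact/differentiable_continuous/derivable1_diffP.
have oo_cc : {subset `]c, b[ <= `[c, b]} by exact: subset_itv_oo_cc.
apply: (@continuous_FTC2 _ _ u) => //.
- exact: continuous_subspaceW cw.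
- split; first by move=> x /oo_cc/cbab/du[].
    by apply/cvg_at_right_filter/u_cont; rewrite in_itv/= lexx ltW.
  by apply/cvg_at_left_filter/u_cont; rewrite in_itv/= lexx ltW.
- by move=> x /oo_cc/cbab/du[_ <-]; rewrite derive1E.
Qed.

(** The image of w dt and Lebesgue measure on [u a, u b] agree on closed right rays. The cases are:
    the ray contains [u a, u b], misses it, or starts inside it. *)
Let mu_rayE c :
  (\int[mu]_(t in `[a, b] `&` u @^-1` `[c, +oo[) (w t)%:E
   = mu (`[u a, u b] `&` `[c, +oo[))%E.
Proof.
have uab : u a < u b by exact: incu.
have [cua|uac] := leP c (u a).
  rewrite !setIidl; last 2 first.
    by move=> x /=; rewrite !in_itv/= andbT => /andP[+ _]; exact: le_trans.
    move=> t /= tab; rewrite in_itv/= andbT (le_trans cua)// mono_u//.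
    by rewrite (itvP tab).
  by rewrite FTC// lebesgue_measure_itv/= lte_fin uab.
have [cub|ubc] := leP c (u b); last first.
  have -> : `[a, b] `&` u @^-1` `[c, +oo[ = set0.
    apply/seteqP; split => // x [] /= xab; rewrite in_itv/= andbT.
    by move=> /(lt_le_trans ubc); rewrite ltNge mono_u// (itvP xab).
  have -> : `[u a, u b] `&` `[c, +oo[ = set0.
    apply/seteqP; split => // x [] /=; rewrite !in_itv/= andbT => /andP[_ xb].
    by move=> /(lt_le_trans ubc) /(le_lt_trans xb); rewrite ltxx.
  by rewrite integral_set0 measure0.
(* The ray pulls back to [e, b], whose mass is u b - u e = u b - c. *)
have [e eab uec] : exists2 e, e \in `[a, b] & u e = c.
  apply: IVT => //; first exact: ltW.
  by rewrite min_l ?max_r ?(ltW uab)// (ltW uac).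
have -> : `[a, b] `&` u @^-1` `[c, +oo[ = `[e, b]%classic.
  apply/seteqP; split => x /=; rewrite !in_itv/= andbT -uec.
    by move=> [xab]; rewrite mono_u// ?in_itv// => ->; case/andP: xab.
  move=> /andP[ex xb]; have xab : x \in `[a, b].
    by rewrite in_itv/= xb (le_trans _ ex)// (itvP eab).
  by split; rewrite ?mono_u// -in_itv.
have -> : `[u a, u b] `&` `[c, +oo[ = `[c, u b]%classic.
  apply/seteqP; split => x /=; rewrite !in_itv/= andbT.
    by move=> [/andP[_ ->] ->].
  by move=> /andP[cx ->]; rewrite andbT cx; split => //; exact/ltW/(lt_le_trans uac).
rewrite FTC// lebesgue_measure_itv/= lte_fin uec.
by case: ltgtP cub => // -> _; rewrite subrr.
Qed.

Lemma ge0_change_of_variables (h : R -> \bar R) :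
  measurable_fun `[u a, u b] h ->
  {in `[u a, u b], forall x, (0 <= h x)%E} ->
  (\int[mu]_(x in `[u a, u b]) h x =
   \int[mu]_(t in `[a, b]) (h (u t) * (w t)%:E))%E.
Proof.
move=> mh h0.
(* Extension by 0 makes both functions measurable on the whole line. The values of [U] off [a, b]
   are harmless: [W] vanishes there, so the measure with density [W] does not see them. *)
pose W : measurableTypeR R -> R := w \_ `[a, b].
pose U : measurableTypeR R -> measurableTypeR R := u \_ `[a, b].
have mW : measurable_fun setT W.
  apply/(measurable_restrictT _ _).1 => //.
  exact: subspace_continuous_measurable_fun.
have mU : measurable_fun setT U.
  apply/(measurable_restrictT _ _).1 => //.
  exact: subspace_continuous_measurable_fun.
have W0 x : 0 <= W x.
  by rewrite /W patchE; case: ifPn => // /set_mem; exact: w0.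
have [nu nuE] := density_measure mu mW W0.
have mUpre A : measurable A -> measurable (U @^-1` A).
  by move=> mA; have := mU measurableT _ mA; rewrite setTI.
have rayE A : @RGenCInfty.G R A ->
    pushforward nu U A = mrestr mu (measurable_itv `[u a, u b]) A.
  move=> [c ->]; rewrite /pushforward /mrestr setIC -mu_rayE nuE; last exact: mUpre.
  rewrite integral_mkcond [RHS]integral_mkcond; apply: eq_integral => x _.
  rewrite !patchE in_setI /W /= patchE.
  have [xab|/negbTE xab] := boolP (x \in `[a, b]%classic) => /=; last first.
    by rewrite if_same.
  have -> // : (x \in U @^-1` `[c, +oo[) = (x \in u @^-1` `[c, +oo[).
  by apply/idP/idP; rewrite !inE /= /U patchE xab.
have muD : (mu `[u a, u b] < +oo)%E.
  by rewrite lebesgue_measure_itv/=; case: ifP => _; rewrite ltry.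
have nuUE A : measurable A ->
    pushforward nu U A = mrestr mu (measurable_itv `[u a, u b]) A.
  pose pushU : {measure set (measurableTypeR R) -> \bar R} := pushforward nu U.
  pose m1 := pushU mU.
  pose m2 : {measure set (measurableTypeR R) -> \bar R} :=
    mrestr mu (measurable_itv `[u a, u b]).
  move: A.
  change (forall A : set (measurableTypeR R), measurable A -> m1 A = m2 A) => A.
  (* Closed right rays generate the Borel sets and are stable under intersection; the rays [-n, +oo[
     exhaust the line and have finite mass, at most that of [u a, u b]. *)
  apply: (@measure_unique _ R (measurableTypeR R) (@RGenCInfty.G R)
    (fun n => `[(- n%:R)%R, +oo[%classic) _ _ _ _ m1 m2) => //.
  - exact: RGenCInfty.measurableE.
  - move=> _ _ [c ->] [e ->]; exists (Num.max c e); apply/seteqP.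
    by split=> x /=; rewrite !in_itv/= !andbT ge_max => /andP.
  - by move=> n; exists (- n%:R).
  - apply/seteqP; split => // x _; exists (Num.truncn `|x|).+1 => //=.
    rewrite in_itv/= andbT lerNl (le_trans (ler_norm _))// normrN.
    by apply/ltW/truncnS_gt.
  - move=> n; rewrite [ltLHS]rayE; last by exists (- n%:R).
    rewrite /mrestr (le_lt_trans (le_measure mu _ _ (@subIsetr _ _ _)))//.
    by rewrite inE; apply: measurableI.
    by rewrite inE.
pose H := h \_ `[u a, u b].
have mH : measurable_fun setT H by apply/(measurable_restrictT _ _).1.
have H0 x : (0 <= H x)%E.
  by rewrite /H patchE; case: ifPn => // /set_mem; exact: h0.
(* On subsets of [u a, u b] the image measure is Lebesgue measure, so [h] may be integrated against
   either. *)
transitivity (\int[pushforward nu U]_x H x)%E.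
  rewrite /H -[RHS]integral_mkcond; apply: eq_measure_integral => A mA AD.
  by rewrite [RHS]nuUE// /mrestr setIidl.
rewrite ge0_integral_pushforward//.
rewrite preimage_setT (ge0_integral_density mW W0 nuE)//.
  rewrite [RHS]integral_mkcond; apply: eq_integral => x _ /=.
  rewrite /H /U /W !patchE.
  have [xab|_] := boolP (x \in `[a, b]%classic); last by rewrite mule0.
  rewrite ifT// mem_setE /= in_itv/=; move: xab; rewrite inE/= => xab.
  by rewrite !mono_u// !(itvP xab).
  exact: measurableT_comp.
by move=> x; exact: H0.
Qed.

(** Multiplication by w >= 0 commutes with taking positive and negative parts, so the nonnegative
    case applies to each part. *)
Lemma change_of_variables (h : R -> \bar R) :
  measurable_fun `[u a, u b] h ->
  (\int[mu]_(x in `[u a, u b]) h x =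
   \int[mu]_(t in `[a, b]) (h (u t) * (w t)%:E))%E.
Proof.
move=> mh; rewrite [LHS]integralE [RHS]integralE.
rewrite !ge0_change_of_variables//; last 2 first.
  exact: measurable_funeneg.
  exact: measurable_funepos.
congr (_ - _)%E; apply: eq_integral => t /[!inE]/= /w0 wt0.
  by rewrite !funeposE maxe_pMl// mul0e.
by rewrite !funenegE maxe_pMl// mul0e mulNe.
Qed.

Lemma integrable_change_of_variables (h : R -> R) :
  mu.-integrable `[u a, u b] (EFin \o h) ->
  mu.-integrable `[a, b] (fun t => (h (u t) * w t)%:E).
Proof.
move=> /integrableP[mh hoo]; apply/integrableP; split.
  apply/measurable_EFinP/measurable_funM.
    apply: (measurable_comp (F := `[u a, u b])) => //; last 2 first.
      exact/measurable_EFinP.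
    exact: subspace_continuous_measurable_fun.
    move=> _ [t /= tab <-]; rewrite in_itv/= !mono_u// !(itvP tab)//.
  exact: subspace_continuous_measurable_fun.
move: hoo; rewrite ge0_change_of_variables//; last exact: measurableT_comp.
congr (_ < _)%E; apply: eq_integral => t /[!inE]/= /w0 wt0.
by rewrite /= normrM (ger0_norm wt0).
Qed.

End ChangeOfVariables.

(** * Two-sided derivatives of functions smooth on a ray *)

Section Smooth.
Context (R : realType).
Implicit Types (g : R -> R) (c x : R).

(** For c < x the ray is a neighbourhood of x, so the limit within the ray is the full limit. *)
Lemma smooth_ray_is_derive c (dn : nat -> R -> R) n x :
  (fun y => (dn n y - dn n x) / (y - x)) @ within [set y | c <= y] x^'
    --> dn n.+1 x ->
  c < x -> is_derive x (1:R) (dn n) (dn n.+1 x).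
Proof.
move=> dnx cx.
suff h_cvg : h^-1 *: ((dn n \o shift x) (h *: (1:R)) - dn n x)
    @[h --> 0^'] --> dn n.+1 x.
  by apply: DeriveDef; [exact: cvgP h_cvg|exact: cvg_lim h_cvg].
apply: cvg_trans dnx => A /=.
rewrite /nbhs/= /within/= /dnbhs /within/= => qA.
have : \forall y \near x, y != x -> A ((dn n y - dn n x) / (y - x)).
  move: (lt_nbhsr cx) qA; apply: filterS2 => y cy q yx.
  by apply: q => //=; exact: ltW.
move=> /(@nbhs0P R R^o); apply: filterS => h /= hA h0.
have /hA : x + h != x by rewrite addrC -subr_eq0 addrK.
by rewrite /= /GRing.scale/= mulr1 addrAC subrr add0r [h + x]addrC mulrC.
Qed.

(** [derive1 g] coincides near x with [dn 1], which is differentiable and hence continuous. *)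
Lemma smooth_ray_derive1 c g x : smooth_ray c g -> c < x ->
  is_derive x (1:R) g (derive1 g x) /\ {for x, continuous (derive1 g)}.
Proof.
move=> [dn [dn0 dnS]] cx.
have gE y : c < y -> is_derive y 1 g (dn 1%N y).
  move=> cy; apply: near_eq_is_derive (smooth_ray_is_derive (dnS 0%N _ (ltW cy)) cy).
  by near=> z; apply/dn0/ltW; near: z; exact: lt_nbhsr.
have g'E y : c < y -> derive1 g y = dn 1%N y.
  by move=> /gE[_ <-]; rewrite derive1E.
split; first by rewrite g'E//; exact: gE.
have [d1 _] := smooth_ray_is_derive (dnS 1%N _ (ltW cx)) cx.
have : {for x, continuous (dn 1%N)}.
  exact/differentiable_continuous/derivable1_diffP.
rewrite /prop_for/continuous_at g'E//; apply: cvg_trans.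
by apply: near_eq_cvg; near=> y; rewrite g'E//; near: y; exact: lt_nbhsr.
Unshelve. all: by end_near. Qed.

End Smooth.

(** * Direct iterates: chain rule and continuity of the derivative *)

Section Iterates.
Context (R : realType) (T0 : R) (phi : R -> R).
Hypotheses (dphi : forall x, T0 < x -> is_derive x (1:R) phi (derive1 phi x))
  (cphi' : forall x, T0 < x -> {for x, continuous (derive1 phi)}).

Lemma is_derive_iter p z : (forall r, (r < p)%N -> T0 < iter r phi z) ->
  is_derive z (1:R) (iter p phi) (\prod_(r < p) derive1 phi (iter r phi z)).
Proof.
elim: p => [|p IH] zp; first by rewrite big_ord0; exact: is_derive_id.
rewrite big_ord_recr/= mulrC.
apply: (is_derive1_comp (f := phi)); first exact/dphi/zp.
by apply: IH => r rp; apply/zp/ltnW.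
Qed.

Lemma continuous_iter p z : (forall r, (r < p)%N -> T0 < iter r phi z) ->
  {for z, continuous (iter p phi)}.
Proof.
move=> /is_derive_iter[dz _]; exact/differentiable_continuous/derivable1_diffP.
Qed.

Lemma continuous_prod_derive_iter p z : (forall r, (r < p)%N -> T0 < iter r phi z) ->
  {for z, continuous (fun z => \prod_(r < p) derive1 phi (iter r phi z))}.
Proof.
elim: p => [|p IH] zp.
  rewrite /prop_for /continuous_at; under eq_fun do rewrite big_ord0.
  rewrite big_ord0; exact: cvg_cst.
rewrite /prop_for /continuous_at; under eq_fun do rewrite big_ord_recr.
rewrite big_ord_recr; apply: cvgM; first by apply: IH => r rp; apply/zp/ltnW.
apply: (continuous_comp (f := iter p phi)); last exact/cphi'/zp.
by apply: continuous_iter => r rp; apply/zp/ltnW.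
Qed.

End Iterates.

(** * Reverse iterates of large points *)

Section ReverseIterates.
Context (R : realType) (T0 : R) (phi : R -> R).
Hypotheses (dphi : forall x, T0 < x -> is_derive x (1:R) phi (derive1 phi x))
  (incphi : {in `[T0, +oo[ &, {homo phi : x y / x < y}})
  (phi_oo : phi t @[t --> +oo] --> +oo).
Local Notation rev := (reverse_iter T0 phi).

Let mono_phi x y : T0 <= x -> T0 <= y -> (phi x <= phi y) = (x <= y).
Proof.
move=> x0 y0; apply: (le_mono_in incphi); by rewrite in_itv/= andbT.
Qed.

(** Continuity and divergence to infinity put every large X in the range of [phi], where [pinv] is a
    true right inverse. *)
Lemma pinv_large (M : R) : exists B, forall X, B < X ->
  M < pinv `[T0, +oo[ phi X /\ phi (pinv `[T0, +oo[ phi X) = X.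
Proof.
(* The + 1 keeps [M'] strictly beyond [T0], so that [phi] is differentiable, hence continuous, on
   [M', N]. *)
pose M' := Num.max M T0 + 1.
have M'T0 : T0 < M' by rewrite ltr_pwDr// le_max lexx orbT.
exists (phi M') => X BX.
have [N [M'N XN]] : exists N, M' < N /\ X < phi N.
  exact: filter_ex (filterI (nbhs_pinfty_gt (num_real M')) (cvgry_gt phi_oo X)).
have [y yM'N yX] : exists2 y, y \in `[M', N] & phi y = X.
  apply: IVT; first exact: ltW.
    apply: derivable_within_continuous => z; rewrite in_itv/= => /andP[M'z _].
    by have [] := dphi (lt_le_trans M'T0 M'z).
  by rewrite min_l ?max_r ?(ltW BX) ?(ltW XN)// ltW// (lt_trans BX).
have imX : (phi @` `[T0, +oo[) X.
  exists y => //=; rewrite in_itv/= andbT; apply: ltW.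
  by apply: (lt_le_trans M'T0); rewrite (itvP yM'N).
have inj : {in `[T0, +oo[%classic &, injective phi}.
  by move=> u v /[!inE] u0 v0; exact: (inc_inj_in (le_mono_in incphi)).
have XK : phi (pinv `[T0, +oo[ phi X) = X by rewrite pinvK ?inE.
(* If the preimage were at most M, monotonicity would give X <= phi M', against the choice of X. *)
split=> //; rewrite ltNge; apply/negP => psiM.
have psiT0 : T0 <= pinv `[T0, +oo[ phi X.
  suff : `[T0, +oo[%classic (pinv `[T0, +oo[ phi X) by rewrite /= in_itv/= andbT.
  by rewrite -[X in X _](injpinv_image (fun=> point) inj); exists X.
have : phi (pinv `[T0, +oo[ phi X) <= phi M'.
  rewrite mono_phi ?(ltW M'T0)// (le_trans psiM)//.
  by rewrite ler_wpDr// le_max lexx.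
by rewrite XK leNgt BX.
Qed.

Lemma reverse_iter_large k : exists2 B, 0 < B & forall X, B < X ->
  forall r, (r <= k)%N -> T0 < rev r X /\ phi (rev r.+1 X) = rev r X.
Proof.
(* The bound M is arbitrary so that the induction on k closes: the inverse image of X must itself
   exceed the threshold found for k. *)
suff H (M : R) : exists B, forall X, B < X -> forall r, (r <= k)%N -> M < rev r X.
  have [M HM] := pinv_large T0.
  (* Exceeding [M] as well makes one further inverse step exact, up to index k + 1. *)
  have [B HB] := H (Num.max T0 M).
  exists (Num.max B 1); first by rewrite lt_max ltr01 orbT.
  move=> X; rewrite gt_max => /andP[/HB BX _] r /BX.
  by rewrite gt_max => /andP[-> /HM[_ ?]].
elim: k M => [|k IH] M; first by exists M => X MX [|].
have [B HB] := IH M; have [B' HB'] := pinv_large B.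
exists (Num.max M B') => X; rewrite gt_max => /andP[MX /HB'[BX _]] [//|r] rk.
by rewrite /reverse_iter iterSr; exact: HB.
Qed.

End ReverseIterates.

(** * Automorphisms of an interval *)

Section Automorphisms.
Context (R : realType).
Implicit Types (a b : R) (u : R -> R).

Lemma automorphism_id a b : automorphism a b id.
Proof.
split => //; first by apply: continuous_subspaceT => ?; exact: cvg_id.
by split => // x xab; exists x.
Qed.

Lemma automorphism_comp a b u1 u2 :
  automorphism a b u1 -> automorphism a b u2 -> automorphism a b (u1 \o u2).
Proof.
move=> [c1 i1 b1] [c2 i2 b2]; have [f2 _ _] := b2.
split; last exact: set_bij_comp b2 b1.
  apply/subspace_continuousP => x xab.
  (* As [u2] maps [a, b] into itself, it carries neighbourhoods within [a, b] of x to those of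
     [u2 x]. *)
  apply: (@cvg_comp _ _ _ u2 u1 _ (within `[a, b] (nbhs (u2 x)))); last first.
    by move/subspace_continuousP : c1 => /(_ (u2 x)); apply; exact: f2.
  move/subspace_continuousP : c2 => /(_ x xab) cu2 P /cu2.
  by rewrite /nbhs/= /within/=; apply: filterS => t u2tP tab; exact/u2tP/f2.
move=> x y xab yab xy; apply: i1.
- by have := f2 x xab.
- by have := f2 y yab.
- exact: i2.
Qed.

Lemma automorphism_inc a b u : a <= b -> {within `[a, b], continuous u} ->
  {in `[a, b] &, {homo u : x y / x < y}} -> u a = a -> u b = b ->
  automorphism a b u.
Proof.
move=> ab cu iu ua ub; split => //.
have mono_u := le_mono_in iu.
have aab : a \in `[a, b] by rewrite in_itv/= lexx ab.
have bab : b \in `[a, b] by rewrite in_itv/= lexx ab.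
split.
- move=> x /= xab; rewrite in_itv/= -{1}ua -{1}ub !mono_u//.
- by move=> x y /[!inE] xab yab; exact: (inc_inj_in mono_u).
- move=> y /= yab; have [|x xab <-] := IVT (v := y) ab cu.
    by rewrite ua ub min_l// max_r// !(itvP yab).
  by exists x.
Qed.

End Automorphisms.

(** * The maps [u_p] and [v_p^r] *)

Section LadderMaps.
Context (R : realType) (T0 : R) (phi : R -> R) (a l T : R) (k : nat).
Hypotheses (dphi : forall x, T0 < x -> is_derive x (1:R) phi (derive1 phi x))
  (cphi' : forall x, T0 < x -> {for x, continuous (derive1 phi)})
  (incphi : {in `[T0, +oo[ &, {homo phi : x y / x < y}})
  (l0 : 0 < l).
Local Notation rev := (reverse_iter T0 phi).
Hypotheses
  (revT : forall r, (r <= k)%N -> T0 < rev r T /\ phi (rev r.+1 T) = rev r T)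
  (revTl : forall r, (r <= k)%N -> T0 < rev r (T + 2 * l) /\
    phi (rev r.+1 (T + 2 * l)) = rev r (T + 2 * l)).
Local Notation b := (a + 2 * l).
Local Notation aff := (rev_affine T0 phi a l T).
Local Notation u := (u_ T0 phi a l T).
Local Notation v := (v_ T0 phi a l T).
Local Notation delta p := (rev p (T + 2 * l) - rev p T).

Let ab : a < b. Proof. by rewrite ltrDl mulr_gt0. Qed.

Let mono_phi x y : T0 < x -> T0 < y -> (phi x <= phi y) = (x <= y).
Proof.
move=> x0 y0; apply: (le_mono_in incphi); by rewrite in_itv/= andbT ltW.
Qed.

Lemma reverse_iter_lt r : (r <= k)%N -> rev r T < rev r (T + 2 * l).
Proof.
elim: r => [|r IH] rk; first by rewrite ltrDl mulr_gt0.
have [T0r phir] := revT rk; have [T0lr philr] := revTl rk.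
rewrite ltNge -mono_phi// -ltNge.
by rewrite (revT (ltnW rk)).2 (revTl (ltnW rk)).2 IH// ltnW.
Qed.

Lemma iter_reverse_iter r p : (r + p <= k)%N ->
  iter r phi (rev (r + p) T) = rev p T /\
  iter r phi (rev (r + p) (T + 2 * l)) = rev p (T + 2 * l).
Proof.
elim: r => // r IH rpk; have [IHT IHTl] := IH (ltnW rpk).
by rewrite !iterSr addSn (revT (ltnW rpk)).2 (revTl (ltnW rpk)).2.
Qed.

Lemma iter_ladder_itv r p z : (r + p <= k)%N ->
  z \in `[rev (r + p) T, rev (r + p) (T + 2 * l)] ->
  iter r phi z \in `[rev p T, rev p (T + 2 * l)].
Proof.
elim: r z => // r IH z rpk zin; rewrite iterSr; apply: IH; first exact: ltnW.
rewrite addSn in zin rpk.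
have z0 : T0 < z by rewrite (lt_le_trans (revT rpk).1)// (itvP zin).
rewrite in_itv/= -(revT (ltnW rpk)).2 -(revTl (ltnW rpk)).2.
by rewrite !mono_phi ?(itvP zin)// ?(revT rpk).1 ?(revTl rpk).1.
Qed.

Section FixedIndex.
Variables (p : nat).
Hypothesis pk : (p <= k)%N.

Let delta0 : 0 < delta p. Proof. by rewrite subr_gt0 reverse_iter_lt. Qed.

Lemma rev_affine_lt t t' : t < t' -> aff p t < aff p t'.
Proof.
move=> tt'; rewrite /rev_affine ltrD2r ltr_pM2l ?ltrD2r//.
by rewrite divr_gt0// mulr_gt0.
Qed.

Lemma rev_affine_left_end : aff p a = rev p T.
Proof. by rewrite /rev_affine subrr mulr0 add0r. Qed.

Lemma rev_affine_right_end : aff p b = rev p (T + 2 * l).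
Proof. by rewrite /rev_affine; field; rewrite gt_eqF. Qed.

Lemma rev_affine_itv t : t \in `[a, b] ->
  aff p t \in `[rev p T, rev p (T + 2 * l)].
Proof.
move=> tab; rewrite in_itv/= -rev_affine_left_end -rev_affine_right_end.
by rewrite !(ltW_homo rev_affine_lt) ?(itvP tab).
Qed.

Lemma ladder_v_itv r t : (r <= p)%N -> t \in `[a, b] ->
  v p r t \in `[rev (p - r) T, rev (p - r) (T + 2 * l)].
Proof.
move=> rp /rev_affine_itv tp; apply: iter_ladder_itv; rewrite subnKC//.
Qed.

Lemma ladder_v_gt r t : (r <= p)%N -> t \in `[a, b] -> T0 < v p r t.
Proof.
move=> rp /(ladder_v_itv rp) vin.
by rewrite (lt_le_trans (revT (leq_trans (leq_subr r p) pk)).1)// (itvP vin).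
Qed.

Definition u_deriv t := delta p / (2 * l) * \prod_(r < p) derive1 phi (v p r t).

Lemma is_derive_affine t : is_derive t (1:R) (aff p) (delta p / (2 * l)).
Proof.
rewrite /rev_affine; apply: is_derive_eq.
by rewrite subr0 addr0 /GRing.scale/= mulr1.
Qed.

Lemma is_derive_u t : t \in `[a, b] -> is_derive t (1:R) (u p) (u_deriv t).
Proof.
move=> tab.
have H : is_derive t (1:R) (iter p phi \o aff p) (u_deriv t).
  rewrite /u_deriv mulrC.
  apply: is_derive1_comp; last exact: is_derive_affine.
  by apply: (is_derive_iter dphi) => r rp; apply: ladder_v_gt => //; exact: ltnW.
rewrite (_ : u p = (iter p phi \o aff p) + cst (a - T)).
  by apply: is_derive_eq; rewrite addr0.
by apply/funext => x; rewrite /u_ /= -addrA [- _ + _]addrC.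
Qed.

Lemma continuous_u_deriv t : t \in `[a, b] -> {for t, continuous u_deriv}.
Proof.
move=> tab; apply: cvgM; first exact: cvg_cst.
apply: (continuous_comp (f := aff p)
  (g := fun z => \prod_(r < p) derive1 phi (iter r phi z))).
  have [d _] := is_derive_affine t.
  exact/differentiable_continuous/derivable1_diffP.
apply: (continuous_prod_derive_iter dphi cphi') => r rp.
by apply: ladder_v_gt => //; exact: ltnW.
Qed.

(** This is what makes the square of [absZtilde] equal to the derivative, since [Num.sqrt] is 0 on
    negative numbers. *)
Lemma derive1_ladder_ge0 x : T0 < x -> 0 <= derive1 phi x.
Proof.
move=> x0; apply: (@incr_derive1_ge0_itvy _ _ true T0) => //.
  by move=> y; rewrite inE/= in_itv/= andbT => /dphi[].
by rewrite in_itv/= andbT.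
Qed.

Lemma u_deriv_ge0 t : t \in `[a, b] -> 0 <= u_deriv t.
Proof.
move=> tab; rewrite /u_deriv mulr_ge0//.
  by rewrite divr_ge0 ?ltW// mulr_gt0.
apply: prodr_ge0 => r _; apply/derive1_ladder_ge0/ladder_v_gt => //.
exact: ltnW.
Qed.

Lemma ladder_v_lt r : (r <= p)%N -> {in `[a, b] &, {homo v p r : x y / x < y}}.
Proof.
elim: r => [|r IH] rp x y xab yab xy; first exact: rev_affine_lt.
rewrite /v_ !iterS; apply: incphi; rewrite ?in_itv/= ?andbT.
- by apply/ltW/ladder_v_gt => //; exact: ltnW.
- by apply/ltW/ladder_v_gt => //; exact: ltnW.
- by apply: IH => //; exact: ltnW.
Qed.

Lemma u_lt : {in `[a, b] &, {homo u p : x y / x < y}}.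
Proof.
move=> x y xab yab xy; rewrite /u_ !ltrD2r.
exact: ladder_v_lt (leqnn p) _ _ _ _ xy.
Qed.

Lemma u_left_end : u p a = a.
Proof.
rewrite /u_ rev_affine_left_end; have := @iter_reverse_iter p 0.
by rewrite addn0 => /(_ pk)[-> _]; rewrite subrr add0r.
Qed.

Lemma u_right_end : u p b = b.
Proof.
rewrite /u_ rev_affine_right_end; have := @iter_reverse_iter p 0.
by rewrite addn0 => /(_ pk)[_ ->]; rewrite /reverse_iter/=; ring.
Qed.

Lemma automorphism_u : automorphism a b (u p).
Proof.
apply: automorphism_inc; rewrite ?u_left_end ?u_right_end ?(ltW ab)//; last exact: u_lt.
by apply: derivable_within_continuous => t /is_derive_u[].
Qed.

End FixedIndex.
End LadderMaps.

(** * Products and multiples of L2 functions *)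

Section SquareIntegrable.
Context (R : realType) (a b : R).
Local Notation mu := (@lebesgue_measure R).

Let mab : measurable (`[a, b]%classic : set (measurableTypeR R)).
Proof. exact: measurable_itv. Qed.

(** Domination by |g h| <= g^2 + h^2. *)
Lemma square_integrableM (g h : R -> R) :
  square_integrable a b g -> square_integrable a b h ->
  mu.-integrable `[a, b] (fun t => (g t * h t)%:E).
Proof.
move=> [mg ig] [mh ih].
apply: (le_integrable _ _ _ (integrableD _ ig ih)) => //.
  by apply/measurable_EFinP; exact: measurable_funM.
move=> t _; rewrite -EFinD !abse_EFin lee_fin.
rewrite [leRHS]ger0_norm ?addr_ge0 ?sqr_ge0//.
by rewrite ler_norml; apply/andP; split; nra.
Qed.

Lemma square_integrableZ (c : R) (g : R -> R) :
  square_integrable a b g -> square_integrable a b (fun t => c * g t).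
Proof.
move=> [mg ig]; split; first exact: measurable_funM.
have := integrableZl mab (c ^+ 2) ig.
by apply: eq_integrable => // t _; rewrite -EFinM exprMn.
Qed.

Lemma RintegralM_scale (c : R) (g h : R -> R) :
  square_integrable a b g -> square_integrable a b h ->
  \int[mu]_(t in `[a, b]) ((c * g t) * (c * h t)) =
  c ^+ 2 * \int[mu]_(t in `[a, b]) (g t * h t).
Proof.
move=> hg hh; rewrite -RintegralZl//; last exact: square_integrableM.
by apply: eq_Rintegral => t _; ring.
Qed.

End SquareIntegrable.

(** * The operator g |-> (g o u) P with P^2 = c u' *)

Section WeightedComposition.
Context (R : realType) (a b c : R) (u w P : R -> R).
Hypotheses (ab : a < b) (cw : {within `[a, b], continuous w})
  (du : {in `[a, b], forall x : R, is_derive x 1 u (w x)})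
  (incu : {in `[a, b] &, {homo u : x y / x < y}})
  (w0 : {in `[a, b], forall x, 0 <= w x})
  (ua : u a = a) (ub : u b = b)
  (mP : measurable_fun `[a, b] P)
  (PE : {in `[a, b], forall t, P t ^+ 2 = c * w t}).
Local Notation mu := (@lebesgue_measure R).

Let mab : measurable (`[a, b]%classic : set (measurableTypeR R)).
Proof. exact: measurable_itv. Qed.

Let cov g : measurable_fun `[a, b] g ->
  (\int[mu]_(x in `[a, b]) g x = \int[mu]_(t in `[a, b]) (g (u t) * (w t)%:E))%E.
Proof.
move=> mg; have := change_of_variables ab cw du incu w0 (h := g).
by rewrite ua ub; exact.
Qed.

Let icov (h : R -> R) : mu.-integrable `[a, b] (EFin \o h) ->
  mu.-integrable `[a, b] (fun t => (h (u t) * w t)%:E).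
Proof.
move=> ih; have := integrable_change_of_variables ab cw du incu w0 (h := h).
by rewrite ua ub; exact.
Qed.

Lemma square_integrable_weighted_comp g : square_integrable a b g ->
  square_integrable a b (fun t => g (u t) * P t).
Proof.
move=> [mg ig]; split.
  apply: measurable_funM => //.
  apply: (measurable_comp (F := `[a, b])) => //.
    move=> _ [t /= tab <-]; rewrite in_itv/= -{1}ua -{1}ub.
    by rewrite !(le_mono_in incu) ?in_itv/= ?lexx ?(ltW ab) ?(itvP tab).
  apply: subspace_continuous_measurable_fun => //.
  by apply: derivable_within_continuous => x /du[].
have := integrableZl mab c (icov ig).
apply: eq_integrable => // t /[!inE]/= tab.
by rewrite -EFinM exprMn PE//; congr _%:E; ring.
Qed.

(** The two weights multiply to c u', which turns the integrand into c times the one produced by the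
    substitution. *)
Lemma Rintegral_weighted_comp g h :
  square_integrable a b g -> square_integrable a b h ->
  \int[mu]_(t in `[a, b]) ((g (u t) * P t) * (h (u t) * P t)) =
  c * \int[mu]_(t in `[a, b]) (g t * h t).
Proof.
move=> hg hh; have igh := square_integrableM hg hh.
rewrite [in RHS]/Rintegral (cov (measurable_int _ igh)).
rewrite -[fine _]/(\int[mu]_(t in `[a, b]) (g (u t) * h (u t) * w t)).
rewrite -RintegralZl//; last exact: (icov igh).
apply: eq_Rintegral => t /[!inE]/= tab.
transitivity (g (u t) * h (u t) * P t ^+ 2); first by ring.
by rewrite PE//; ring.
Qed.

End WeightedComposition.

(** * Recursion between generations *)

Section GenerationAlgebra.
Context (R : realType) (T0 : R) (phi : R -> R) (a l T : R).
Local Notation u := (u_ T0 phi a l T).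

Definition ladder_weight (p : nat) (t : R) : R :=
  \prod_(r < p) absZtilde phi (v_ T0 phi a l T p r t).

Lemma generation0 f : generation T0 phi a l T f [::] = f.
Proof.
by apply/funext => n; apply/funext => t; rewrite /generation big_ord0 mulr1.
Qed.

(** A new index is appended on the right because its [u_p] is innermost: the old factors are
    evaluated at [u p t], and only the last factor is new. *)
Lemma generation_rcons f ps p n t :
  generation T0 phi a l T f (rcons ps p) n t =
  generation T0 phi a l T f ps n (u p t) * ladder_weight p t.
Proof.
rewrite /generation /u_comp foldr_rcons size_rcons big_ord_recr/= mulrA.
rewrite nth_rcons ltnn eqxx [drop (size ps).+1 _]drop_oversize ?size_rcons//=.
congr (_ * _ * _); apply: eq_bigr => i _; rewrite nth_rcons ltn_ord.
apply: eq_bigr => r _.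
by rewrite drop_rcons// foldr_rcons.
Qed.

End GenerationAlgebra.

(** * Orthogonality and normalization of the generations *)

Section Generations.
Context (R : realType) (T0 : R) (phi : R -> R) (a l T : R) (k : nat).
Hypotheses (dphi : forall x, T0 < x -> is_derive x (1:R) phi (derive1 phi x))
  (cphi' : forall x, T0 < x -> {for x, continuous (derive1 phi)})
  (incphi : {in `[T0, +oo[ &, {homo phi : x y / x < y}})
  (l0 : 0 < l).
Local Notation rev := (reverse_iter T0 phi).
Hypotheses
  (revT : forall r, (r <= k)%N -> T0 < rev r T /\ phi (rev r.+1 T) = rev r T)
  (revTl : forall r, (r <= k)%N -> T0 < rev r (T + 2 * l) /\
    phi (rev r.+1 (T + 2 * l)) = rev r (T + 2 * l)).
Local Notation b := (a + 2 * l).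
Local Notation u := (u_ T0 phi a l T).
Local Notation v := (v_ T0 phi a l T).
Local Notation delta p := (rev p (T + 2 * l) - rev p T).
Local Notation weight := (ladder_weight T0 phi a l T).
Local Notation gen := (generation T0 phi a l T).
Local Notation mu := (@lebesgue_measure R).

Let ab : a < b. Proof. by rewrite ltrDl mulr_gt0. Qed.

Let delta_gt0 p : (p <= k)%N -> 0 < delta p.
Proof. by move=> pk; rewrite subr_gt0 (reverse_iter_lt incphi l0 revT revTl). Qed.

Lemma ladder_weight_sqr p t : (p <= k)%N -> t \in `[a, b] ->
  weight p t ^+ 2 = 2 * l / delta p * u_deriv T0 phi a l T p t.
Proof.
move=> pk tab; rewrite /u_deriv mulrA.
rewrite [_ * (_ / _)]mulrC mulrA divfK ?mulfV ?gt_eqF ?mulr_gt0 ?delta_gt0// mul1r.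
rewrite -prodrXl; apply: eq_bigr => r _; rewrite sqr_sqrtr//.
apply/(derive1_ladder_ge0 dphi incphi).
by apply: (ladder_v_gt incphi l0 revT revTl pk) => //; exact: ltnW.
Qed.

(** Being nonnegative, the weight is the square root of its square, a continuous function on
    [a, b]. *)
Lemma measurable_ladder_weight p : (p <= k)%N ->
  measurable_fun `[a, b] (weight p).
Proof.
move=> pk.
apply: (eq_measurable_fun
    (Num.sqrt \o (fun t => 2 * l / delta p * u_deriv T0 phi a l T p t))).
  move=> t /[!inE]/= tab; rewrite -ladder_weight_sqr// sqrtr_sqr ger0_norm//.
  by apply: prodr_ge0 => r _; exact: sqrtr_ge0.
apply: subspace_continuous_measurable_fun => //.
apply: continuous_in_subspaceT => t /[!inE]/= tab.
apply: continuous_comp; last exact: sqrt_continuous.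
apply: cvgM; first exact: cvg_cst.
exact: (continuous_u_deriv dphi cphi' incphi l0 revT revTl pk).
Qed.

Let cw p : (p <= k)%N -> {within `[a, b], continuous (u_deriv T0 phi a l T p)}.
Proof.
move=> pk; apply: continuous_in_subspaceT => t /[!inE]/= tab.
exact: (continuous_u_deriv dphi cphi' incphi l0 revT revTl pk).
Qed.

Lemma square_integrable_ladder p g : (p <= k)%N ->
  square_integrable a b g ->
  square_integrable a b (fun t => g (u p t) * weight p t).
Proof.
move=> pk; apply: (square_integrable_weighted_comp ab (cw pk) _ _ _ _ _
  (measurable_ladder_weight pk)
  (fun t => @ladder_weight_sqr p t pk)).
- exact: (is_derive_u dphi incphi l0 revT revTl pk).
- exact: (u_lt incphi l0 revT revTl pk).
- exact: (u_deriv_ge0 dphi incphi l0 revT revTl pk).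
- exact: (u_left_end a revT revTl pk).
- exact: (u_right_end a l0 revT revTl pk).
Qed.

Lemma Rintegral_ladder p g h : (p <= k)%N ->
  square_integrable a b g -> square_integrable a b h ->
  \int[mu]_(t in `[a, b]) ((g (u p t) * weight p t) * (h (u p t) * weight p t)) =
  2 * l / delta p * \int[mu]_(t in `[a, b]) (g t * h t).
Proof.
move=> pk hg hh; apply: (@Rintegral_weighted_comp _ a b _ (u p) _ (weight p)
  ab (cw pk) _ _ _ _ _
  (fun t => @ladder_weight_sqr p t pk)) => //.
- exact: (is_derive_u dphi incphi l0 revT revTl pk).
- exact: (u_lt incphi l0 revT revTl pk).
- exact: (u_deriv_ge0 dphi incphi l0 revT revTl pk).
- exact: (u_left_end a revT revTl pk).
- exact: (u_right_end a l0 revT revTl pk).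
Qed.

(** Both claims go through one induction, since scaling the inner product at each step requires the
    previous generation to be in L2. *)
Lemma generation_inner f ps : (forall n, square_integrable a b (f n)) ->
  all (fun p => p <= k)%N ps ->
  (forall n, square_integrable a b (gen f ps n)) /\
  (forall m n, \int[mu]_(t in `[a, b]) (gen f ps m t * gen f ps n t) =
    (\prod_(p <- ps) (2 * l / delta p)) * \int[mu]_(t in `[a, b]) (f m t * f n t)).
Proof.
move=> hf; elim/last_ind: ps => [_|ps p IH].
  by rewrite generation0 big_nil; split => // m n; rewrite mul1r.
rewrite all_rcons => /andP[pk /IH[IHT IHTl]].
have gE n : gen f (rcons ps p) n = fun t => gen f ps n (u p t) * weight p t.
  by apply/funext => t; rewrite generation_rcons.
split=> [n|m n]; first by rewrite gE; exact: square_integrable_ladder.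
by rewrite !gE Rintegral_ladder// IHTl big_rcons/= mulrA [_ * \prod_(_ <- _) _]mulrC.
Qed.

Lemma automorphism_u_comp ps : all (fun p => p <= k)%N ps ->
  automorphism a b (u_comp T0 phi a l T ps).
Proof.
elim: ps => [_|p ps IH /= /andP[pk /IH hps]]; first exact: automorphism_id.
apply: (@automorphism_comp _ _ _ (u p)) => //.
exact: (automorphism_u a dphi incphi l0 revT revTl pk).
Qed.

(** Each operator multiplies squared norms by 2l / delta p, so the correcting factor is the
    reciprocal root, one for each entry p of [ps] rather than for each generation. *)
Lemma normalizer_sqr ps : all (fun p => p <= k)%N ps ->
  normalizer T0 phi l T ps ^+ 2 * \prod_(p <- ps) (2 * l / delta p) = 1.
Proof.
rewrite /normalizer; elim: ps => [_|p ps IH /= /andP[pk /IH hps]].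
  by rewrite !big_nil expr1n mul1r.
have dp := delta_gt0 pk.
rewrite !big_cons exprMn sqr_sqrtr ?divr_ge0 ?ltW ?mulr_gt0//.
rewrite mulrACA hps mulr1 mulrA divfK ?divff// gt_eqF// mulr_gt0//.
Qed.

Lemma l2_orthogonal_generation f ps : l2_orthogonal a b f ->
  all (fun p => p <= k)%N ps -> l2_orthogonal a b (gen f ps).
Proof.
move=> [hf fmn] /(generation_inner hf)[g1 g2]; split=> // m n mn.
by rewrite g2 fmn// mulr0.
Qed.

Lemma l2_orthonormal_generation f ps : l2_orthonormal a b f ->
  all (fun p => p <= k)%N ps ->
  l2_orthonormal a b (fun n t => normalizer T0 phi l T ps * gen f ps n t).
Proof.
move=> [[hf fmn] fn] hps; have [g1 g2] := generation_inner hf hps.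
split; first split.
- by move=> n; exact: square_integrableZ.
- by move=> m n mn; rewrite RintegralM_scale// g2 fmn// !mulr0.
- move=> n; under eq_Rintegral do rewrite expr2.
  rewrite RintegralM_scale// g2 mulrA normalizer_sqr// mul1r.
  by apply: etrans (fn n); apply: eq_Rintegral => t _; rewrite expr2.
Qed.

End Generations.

(** This is the continuum of possible T in (e); y |-> c + e^y is the bijection. *)
Lemma card_ray (R : realType) (c : R) : ([set x : R | c < x] #= [set: R])%card.
Proof.
suff <- : (fun y => c + expR y) @` [set: R] = [set x | c < x].
  by apply: inj_card_eq => y z _ _ /addrI/expR_inj.
apply/seteqP; split => [_ [y _ <-]|x /= cx] /=; first by rewrite ltrDl expR_gt0.
by exists (ln (x - c)) => //; rewrite lnK ?posrE ?subr_gt0// addrC subrK.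
Qed.

Theorem theorem1 (R : realType) (y0 Tstart T0 : R) (mu phi : R -> R)
    (hmu : admissible_mu y0 mu)
    (hphi : continuous_solution y0 mu Tstart phi)
    (hphi1 : ladder_properties T0 (ladder phi)) :
  exists G : forall (T a l : R) (k : nat),
      (nat -> R -> R) -> k.-tuple (nat -> R -> R),
  forall (a l : R) (f : nat -> R -> R),
    0 < l -> l2_orthogonal a (a + 2 * l) f ->
  forall k s : nat, (0 < k)%N -> (0 < s)%N ->
  exists T1 : R,
    [/\ 0 < T1,
        ([set T : R | (T1 < T)%R] #= [set: R])%card &
    forall T : R, T1 < T ->
      let u := u_ T0 (ladder phi) a l T in
      let v := v_ T0 (ladder phi) a l T in
      let uu := u_comp T0 (ladder phi) a l T in
      let Zt := absZtilde (ladder phi) in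
      let f1 (p1 n : nat) (t : R) := f n (u p1 t) * \prod_(r < p1) Zt (v p1 r t) in
      let f2 (p1 p2 n : nat) (t : R) :=
        f n (u p1 (u p2 t))
        * (\prod_(r < p1) Zt (v p1 r (u p2 t)))
        * (\prod_(r < p2) Zt (v p2 r t)) in
      let fs := generation T0 (ladder phi) a l T f in
      let valid (ps : seq nat) := all (fun p => 1 <= p <= k)%N ps in
      [/\ (* (a) *)
          (forall (j : 'I_k) (n : nat),
             {in `[a, a + 2 * l], tnth (G T a l k f) j n =1 f1 j.+1 n}) /\
          (forall p1 : nat, (1 <= p1 <= k)%N ->
             l2_orthogonal a (a + 2 * l) (f1 p1) /\
             automorphism a (a + 2 * l) (u p1)),
          (* (b) *)
          (forall p1 : nat, (1 <= p1 <= k)%N ->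
             forall (j : 'I_k) (n : nat),
             {in `[a, a + 2 * l],
               tnth (G T a l k (f1 p1)) j n =1 f2 p1 j.+1 n}) /\
          (forall p1 p2 : nat, (1 <= p1 <= k)%N -> (1 <= p2 <= k)%N ->
             l2_orthogonal a (a + 2 * l) (f2 p1 p2) /\
             automorphism a (a + 2 * l) (fun t => u p1 (u p2 t))),
          (* (c) *)
          (forall ps : seq nat, valid ps -> (size ps < s)%N ->
             forall (j : 'I_k) (n : nat),
             {in `[a, a + 2 * l],
               tnth (G T a l k (fs ps)) j n =1 fs (rcons ps j.+1) n}) /\
          (forall ps : seq nat, valid ps -> (1 <= size ps <= s)%N ->
             l2_orthogonal a (a + 2 * l) (fs ps) /\
             automorphism a (a + 2 * l) (uu ps))
        & (* (d) *)
          l2_orthonormal a (a + 2 * l) f ->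
          forall ps : seq nat, valid ps -> size ps = s ->
            l2_orthonormal a (a + 2 * l)
              (fun n t => normalizer T0 (ladder phi) l T ps * fs ps n t)]].
Proof.
set phi1 := ladder phi.
have [_ smooth inc _ phi_oo] := hphi1.
have dphi x : T0 < x -> is_derive x (1:R) phi1 (derive1 phi1 x).
  by move=> x0; have [] := smooth_ray_derive1 smooth x0.
have cphi' x : T0 < x -> {for x, continuous (derive1 phi1)}.
  by move=> x0; have [] := smooth_ray_derive1 smooth x0.
(* The operator is an explicit formula on arbitrary sequences, chosen before f. Ordinals count from
   0, hence the index j + 1. *)
exists (fun T a l k g => [tuple (fun n t =>
  g n (u_ T0 phi1 a l T j.+1 t) * ladder_weight T0 phi1 a l T j.+1 t) | j < k]).
move=> a l f l0 hf k s k0 s0.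
(* The threshold depends on the ladder and k only; as T + 2l > T, it serves both end points. *)
have [B B0 HB] := reverse_iter_large dphi inc phi_oo k.
exists B; split=> //; first exact: card_ray.
move=> T BT u v uu Zt f1 f2 fs valid.
have revT := HB T BT.
have revTl : forall r, (r <= k)%N ->
    T0 < reverse_iter T0 phi1 r (T + 2 * l) /\
    phi1 (reverse_iter T0 phi1 r.+1 (T + 2 * l))
    = reverse_iter T0 phi1 r (T + 2 * l).
  by apply: HB; rewrite (lt_trans BT)// ltrDl mulr_gt0.
have validW ps : valid ps -> all (fun p => p <= k)%N ps.
  by apply: sub_all => p /andP[].
have ortho ps : valid ps -> l2_orthogonal a (a + 2 * l) (fs ps).
  by move=> /validW; exact: (l2_orthogonal_generation dphi cphi' inc l0 revT revTl).
have auto ps : valid ps -> automorphism a (a + 2 * l) (uu ps).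
  by move=> /validW; exact: (automorphism_u_comp _ dphi inc l0 revT revTl).
(* The first two generations are those of lists of length one and two, so (a) and (b) reduce to the
   general case. *)
have f1E p : f1 p = fs [:: p].
  apply/funext => n; apply/funext => t.
  by rewrite /fs (generation_rcons _ _ _ _ _ _ [::]) generation0.
have f2E p q : f2 p q = fs [:: p; q].
  apply/funext => n; apply/funext => t.
  by rewrite /fs (generation_rcons _ _ _ _ _ _ [:: p]) -/fs -f1E.
split; [split|split|split|].
- by move=> j n t _; rewrite tnth_mktuple.
- move=> p pk; rewrite f1E; have vp : valid [:: p] by rewrite /valid/= pk.
  by split; [exact: ortho|exact: auto vp].
- by move=> p pk j n t _; rewrite tnth_mktuple.
- move=> p q pk qk; rewrite f2E.
  have vpq : valid [:: p; q] by rewrite /valid/= pk qk.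
  by split; [exact: ortho|exact: auto vpq].
- by move=> ps _ _ j n t _; rewrite tnth_mktuple /fs generation_rcons.
- by move=> ps vps _; split; [exact: ortho|exact: auto].
- move=> hfn ps /validW vps _.
  exact: (l2_orthonormal_generation dphi cphi' inc l0 revT revTl).
Qed.
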